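(* Let $X$ be a Banach space with the Dunford-Pettis property. If $X$ is weakly almost square, then the $N$-fold projective symmetric tensor product $\widehat{\otimes}_{\pi,s,N}X$ has the local diameter two property for each $N\in\mathbb{N}$.
   Context: All Banach spaces are real and non-zero. $B_X$ and $S_X$ denote the closed unit ball and the unit sphere of $X$. A Banach space $X$ has the Dunford-Pettis property if every weakly compact operator $T:X\to Y$ (into any Banach space $Y$) is weak-to-norm sequentially continuous, i.e. whenever $x_n\to x$ weakly in $X$ then $Tx_n\to Tx$ in norm in $Y$. A Banach space $X$ is weakly almost square (WASQ) if for every $x\in S_X$ there exists a sequence $\{y_n\}$ in $B_X$ such that $\|x\pm y_n\|\to 1$, $\|y_n\|\to 1$ and $y_n\to 0$ weakly. The $N$-fold symmetric tensor product $\otimes^{s,N}X$ is the linear span of the tensors $x^N:=x\otimes\cdots\otimes x$ in $\otimes^N X$. The $N$-fold projective symmetric tensor product $\widehat{\otimes}_{\pi,s,N}X$ is the completion of $\otimes^{s,N}X$ under the norm $\|u\|:=\inf\{\sum_{i=1}^n|\lambda_i|\|x_i\|^N : u=\sum_{i=1}^n\lambda_i x_i^N,\ n\in\mathbb{N},\ \lambda_i\in\mathbb{R},\ x_i\in X\}$. A Banach space $Z$ has the local diameter two property (LD2P) if each slice of $B_Z$, i.e. each set $\{z\in B_Z: z^*(z)>1-\alpha\}$ with $z^*\in S_{Z^*}$ and $\alpha>0$, has diameter two. *)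

(* Defs.v *)
From HB Require Import structures.
From mathcomp Require Import all_boot all_order all_algebra.
From mathcomp Require Import generic_quotient ring_quotient lra.
From mathcomp Require Import all_classical all_reals all_analysis.

Set Implicit Arguments.
Unset Strict Implicit.
Unset Printing Implicit Defensive.

Import Order.TTheory GRing.Theory Num.Theory.
Import numFieldNormedType.Exports.

Local Open Scope classical_set_scope.
Local Open Scope ring_scope.

Definition unit_ball (R : realType) (X : normedModType R) : set X :=
  [set x | `|x| <= 1].
Arguments unit_ball {R} X _.

Definition dual (R : realType) (X : normedModType R) :=
  {f : {linear X -> R^o} | continuous f}.

Definition dual_fun (R : realType) (X : normedModType R) (f : dual X) : X -> R :=
  sval f.

Coercion dual_fun : dual >-> Funclass.

Definition dual_norm (R : realType) (X : normedModType R) (f : dual X) : R :=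
  sup [set `|f x| | x in unit_ball X].

(* A copy of X carrying the topology induced by its dual. *)
Definition weak (R : realType) (X : normedModType R) :=
  initial_topology (fun (x : X) => (fun f : dual X => f x) : {ptws dual X -> R}).

HB.instance Definition _ (R : realType) (X : normedModType R) :=
  Topological.on (weak X).

Lemma weak_cvgP (R : realType) (X : normedModType R) (u : nat -> X) (x : X) :
  (u : nat -> weak X) @ \oo --> (x : weak X) <->
  forall f : dual X, f (u n) @[n --> \oo] --> f x.
Proof.
pose j : weak X -> {ptws dual X -> R} := fun x f => f x.
have cj : continuous j by exact: initial_continuous.
split=> [cu f|cu].
  have /cvg_sup/(_ f) h := cvg_comp _ _ cu (cj x).
  exact: (cvg_comp _ _ h
    (@initial_continuous _ R (@proj (dual X) (fun=> R) f) (j x))).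
have ju : (j \o u) @ \oo --> j x.
  apply/cvg_sup => f A.
  rewrite (@nbhsE (initial_topology (@proj (dual X) (fun=> R) f))).
  move=> [B [[C oC <-] /= Cx] sB].
  apply: filterS sB _; apply: (cu f); exact: open_nbhs_nbhs.
move=> A; rewrite (@nbhsE (weak X)) => -[B [[C oC <-] /= Cx] sB].
by apply: filterS sB _; apply: ju; exact: open_nbhs_nbhs.
Qed.

Definition weakly_compact_operator (R : realType) (X Y : normedModType R)
    (T : {linear X -> Y}) : Prop :=
  continuous T /\ precompact (T @` unit_ball X : set (weak Y)).

Definition dunford_pettis (R : realType) (X : completeNormedModType R) : Prop :=
  forall (Y : completeNormedModType R) (T : {linear X -> Y}),
    weakly_compact_operator T ->
  forall (u : nat -> X) (x : X),
    (u : nat -> weak X) @ \oo --> (x : weak X) ->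
    T (u n) @[n --> \oo] --> T x.

Definition weakly_almost_square (R : realType) (X : completeNormedModType R) : Prop :=
  forall x : X, `|x| = 1 ->
  exists y : nat -> X,
    [/\ forall n, unit_ball X (y n),
        `|x + y n| @[n --> \oo] --> (1 : R) /\
        `|x - y n| @[n --> \oo] --> (1 : R),
        `|y n| @[n --> \oo] --> (1 : R) &
        (y : nat -> weak X) @ \oo --> (0 : weak X)].

Definition diameter (R : realType) (X : normedModType R) (A : set X) : \bar R :=
  ereal_sup [set (`|p.1 - p.2|)%:E | p in A `*` A].

Definition slice (R : realType) (X : normedModType R) (f : dual X) (alpha : R)
  : set X := unit_ball X `&` [set x | 1 - alpha < f x].

Definition local_diameter_two (R : realType) (X : completeNormedModType R) : Prop :=
  forall (f : dual X) (alpha : R),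
    dual_norm f = 1 -> 0 < alpha -> diameter (slice f alpha) = 2%:E.

Record multiform (R : realType) (X : lmodType R) (N : nat) := Multiform {
  mform :> ('I_N -> X) -> R ;
  mform_linear : forall (v : 'I_N -> X) (i : 'I_N) (a : R) (x y : X),
    mform (dfwith v i (a *: x + y)) =
    a * mform (dfwith v i x) + mform (dfwith v i y) }.

(* Multilinear forms separate the elements of the algebraic tensor product over
   a field, so it is realized inside the linear functionals on them, the
   elementary tensor of v being the evaluation at v. *)
Definition elem_tensor (R : realType) (X : lmodType R) (N : nat) (v : 'I_N -> X)
  : multiform X N -> R^o := fun A => A v.

Definition tensor_power (R : realType) (X : lmodType R) (N : nat) (x : X)
  : multiform X N -> R^o := elem_tensor (fun _ : 'I_N => x).

Arguments tensor_power {R X} N x _.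

(* The list s = [:: (l_1, x_1); ...; (l_n, x_n)] encodes the formal sum of the
   l_i x_i^N. *)
Definition power_sum (R : realType) (X : lmodType R) (N : nat) (s : seq (R * X))
  : multiform X N -> R^o := \sum_(p <- s) p.1 *: tensor_power N p.2.

Arguments power_sum {R X} N s _.

Definition is_sym_tensor (R : realType) (X : lmodType R) (N : nat)
  : {pred multiform X N -> R^o} :=
  fun u => `[< exists s : seq (R * X), u = power_sum N s >].

Lemma is_sym_tensor_submod (R : realType) (X : lmodType R) (N : nat) :
  submod_closed (@is_sym_tensor R X N).
Proof.
split=> [|a u v /asboolP[s ->] /asboolP[t ->]]; apply/asboolP.
  by exists [::]; rewrite /power_sum big_nil.
exists ([seq (a * p.1, p.2) | p <- s] ++ t).
rewrite /power_sum big_cat big_map scaler_sumr; congr (_ + _).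
by apply: eq_bigr => p _; rewrite scalerA.
Qed.

HB.instance Definition _ (R : realType) (X : lmodType R) (N : nat) :=
  GRing.isSubmodClosed.Build R _ (@is_sym_tensor R X N)
    (@is_sym_tensor_submod R X N).

Record sym_tensor (R : realType) (X : lmodType R) (N : nat) := SymTensor {
  sym_val : multiform X N -> R^o ;
  sym_valP : sym_val \in @is_sym_tensor R X N }.

HB.instance Definition _ (R : realType) (X : lmodType R) (N : nat) :=
  [isSub for @sym_val R X N].
HB.instance Definition _ (R : realType) (X : lmodType R) (N : nat) :=
  [Choice of sym_tensor X N by <:].
HB.instance Definition _ (R : realType) (X : lmodType R) (N : nat) :=
  [SubChoice_isSubLmodule of sym_tensor X N by <:].

Definition proj_sym_norm (R : realType) (X : normedModType R) (N : nat)
    (u : sym_tensor X N) : R :=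
  inf [set \sum_(p <- s) `|p.1| * `|p.2| ^+ N
      | s in [set s : seq (R * X) | val u = power_sum N s]].

(* A normed space has exactly one completion up to isometric isomorphism. *)
Definition is_completion (R : realType) (V : lmodType R) (norm : V -> R)
    (Z : completeNormedModType R) (iota : {linear V -> Z}) : Prop :=
  (forall u, `|iota u| = norm u) /\ dense (range iota).

Definition is_proj_sym_tensor (R : realType) (X : normedModType R) (N : nat)
    (Z : completeNormedModType R) (iota : {linear sym_tensor X N -> Z}) : Prop :=
  is_completion (@proj_sym_norm R X N) iota.

(* The rest of the file shows that projective symmetric tensor products exist,
   the completion being built from Cauchy sequences modulo null sequences. *)

Module Existence.

Record seminorm (R : realType) (V : lmodType R) := Seminorm {
  snorm :> V -> R ;
  snormD : forall x y, snorm (x + y) <= snorm x + snorm y ;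
  snormZ : forall a x, snorm (a *: x) = `|a| * snorm x }.

Lemma half_gt0 (R : realType) (e : R) : 0 < e -> 0 < e / 2.
Proof. by move=> e0; rewrite divr_gt0. Qed.

Section Completion.
Local Open Scope quotient_scope.
Context {R : realType} {V : lmodType R}.
Variable p : seminorm V.

Lemma snorm0 : p 0 = 0.
Proof. by rewrite -(scale0r (0 : V)) snormZ normr0 mul0r. Qed.

Lemma snormN x : p (- x) = p x.
Proof. by rewrite -scaleN1r snormZ normrN1 mul1r. Qed.

Lemma snorm_ge0 x : 0 <= p x.
Proof. have := snormD p x (- x); rewrite subrr snorm0 snormN; lra. Qed.

Lemma snormB_le x y : `|p x - p y| <= p (x - y).
Proof.
have := snormD p (x - y) y; rewrite subrK.
have := snormD p (y - x) x; rewrite subrK -(opprB x y) snormN.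
by rewrite ler_norml; move=> *; apply/andP; split; lra.
Qed.

Definition cauchy_pred : {pred nat -> V} := fun u => `[< forall e : R, 0 < e ->
  exists k, forall m n, (k <= m)%N -> (k <= n)%N -> p (u m - u n) < e >].

Lemma cauchy_submod : submod_closed cauchy_pred.
Proof.
split=> [|a u v /asboolP cu /asboolP cv]; apply/asboolP => e e0.
  by exists 0%N => m n _ _; rewrite subrr snorm0.
have d0 : 0 < (e / 2) / (`|a| + 1) by rewrite !divr_gt0 ?addr_ge0 // ltr_wpDl.
have [k1 h1] := cu _ d0.
have [k2 h2] := cv (e / 2) (half_gt0 e0).
exists (maxn k1 k2) => m n; rewrite !geq_max => /andP[m1 m2] /andP[n1 n2].
have -> : (a *: u + v) m - (a *: u + v) n = a *: (u m - u n) + (v m - v n).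
  by rewrite scalerBr opprD addrACA.
apply: (le_lt_trans (snormD _ _ _)).
rewrite [ltRHS](splitr e); apply: ler_ltD; last exact: h2.
rewrite snormZ.
have /ltW := h1 _ _ m1 n1; rewrite ler_pdivlMr ?ltr_wpDl // mulrC.
apply: le_trans; apply: ler_wpM2r; [exact: snorm_ge0|by rewrite lerDl].
Qed.

HB.instance Definition _ := GRing.isSubmodClosed.Build R _ cauchy_pred cauchy_submod.

Record cseq := Cseq { cval : nat -> V ; cvalP : cval \in cauchy_pred }.
HB.instance Definition _ := [isSub for cval].
HB.instance Definition _ := [Choice of cseq by <:].
HB.instance Definition _ := [SubChoice_isSubLmodule of cseq by <:].

Lemma cseqP (u : cseq) : forall e : R, 0 < e ->
  exists k, forall m n, (k <= m)%N -> (k <= n)%N -> p (cval u m - cval u n) < e.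
Proof. by have /asboolP := cvalP u. Qed.

Definition lnorm (u : cseq) : R := limn (fun n => p (cval u n)).

Lemma lnorm_cvg (u : cseq) : (fun n => p (cval u n)) @ \oo --> lnorm u.
Proof.
apply: cauchy_cvg; apply: cauchy_exP => /= e e0.
have [k hk] := cseqP u e0.
exists (p (cval u k)); exists k => // n /= kn.
by rewrite /ball /=; apply: (le_lt_trans (snormB_le _ _)); apply: hk.
Qed.

Lemma lnormD u v : lnorm (u + v) <= lnorm u + lnorm v.
Proof.
have h : (fun n => p (cval u n) + p (cval v n)) @ \oo --> lnorm u + lnorm v.
  by apply: cvgD; exact: lnorm_cvg.
apply: (ler_cvg_to (@lnorm_cvg _) h).
by apply: nearW => n; exact: snormD.
Qed.

Lemma lnormZ a u : lnorm (a *: u) = `|a| * lnorm u.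
Proof.
apply: (cvg_unique _ (@lnorm_cvg _)); first exact: Rhausdorff.
rewrite (_ : (fun n => _) = (fun n => `|a| * p (cval u n))); last first.
  by apply/funext => n; rewrite -snormZ.
by apply: cvgMl_tmp; exact: lnorm_cvg.
Qed.

Lemma lnorm0 : lnorm 0 = 0. Proof. by rewrite -(scale0r (0 : cseq)) lnormZ normr0 mul0r. Qed.

Lemma lnormN x : lnorm (- x) = lnorm x.
Proof. by rewrite -scaleN1r lnormZ normrN1 mul1r. Qed.

Lemma lnorm_ge0 x : 0 <= lnorm x.
Proof. have := lnormD x (- x); rewrite subrr lnorm0 lnormN; lra. Qed.

Definition null_pred : {pred cseq} := fun u => lnorm u == 0.
Lemma null_submod : submod_closed null_pred.
Proof.
split=> [|a u v /eqP cu /eqP cv]; first by apply/eqP; exact: lnorm0.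
apply/eqP/le_anti; rewrite lnorm_ge0 andbT (le_trans (lnormD _ _))//.
by rewrite lnormZ cu cv mulr0 addr0.
Qed.
HB.instance Definition _ := GRing.isSubmodClosed.Build R _ null_pred null_submod.

Definition completion := {ideal_quot null_pred}.
HB.instance Definition _ := GRing.Zmodule.on completion.
HB.instance Definition _ := Quotient.on completion.

Definition cpi (u : cseq) : completion := \pi_completion u.
Lemma cpiD : {morph cpi : x y / x + y}.
Proof. by move=> x y; rewrite /cpi; exact: (raddfD (\pi_{ideal_quot null_pred})). Qed.

Lemma cpi_eq u v : (cpi u = cpi v) <-> lnorm (u - v) = 0.
Proof.
have E := Quotient.idealrBE null_pred u v.
split=> [h|h]; first by apply/eqP; rewrite -[_ == _]/(u - v \in null_pred) E; apply/eqP.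
by apply/eqP; rewrite -[_ == _]E; apply/eqP.
Qed.

Lemma cpi_repr (z : completion) : cpi (repr z) = z.
Proof. exact: reprK. Qed.

Definition cscale (a : R) (z : completion) : completion := cpi (a *: repr z).
Lemma cpiZ a u : cscale a (cpi u) = cpi (a *: u).
Proof.
apply/cpi_eq; rewrite -scalerBr lnormZ; apply/eqP; rewrite mulf_eq0; apply/orP; right.
by apply/eqP/cpi_eq; rewrite cpi_repr.
Qed.

Lemma csA a b z : cscale a (cscale b z) = cscale (a * b) z.
Proof. by rewrite -(cpi_repr z) !cpiZ scalerA. Qed.

Lemma cs1 : left_id 1 cscale.
Proof. by move=> z; rewrite -(cpi_repr z) cpiZ scale1r. Qed.

Lemma csDr : right_distributive cscale +%R.
Proof. by move=> a y z; rewrite -(cpi_repr z) -(cpi_repr y) -cpiD !cpiZ -cpiD scalerDr. Qed.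

Lemma csDl z : {morph cscale^~ z : a b / a + b}.
Proof. by move=> a b /=; rewrite -(cpi_repr z) !cpiZ -cpiD scalerDl. Qed.
HB.instance Definition _ := GRing.Zmodule_isLmodule.Build R completion csA cs1 csDr csDl.

Lemma cpiZE a u : a *: cpi u = cpi (a *: u). Proof. exact: cpiZ. Qed.

Definition cnorm (z : completion) : R := lnorm (repr z).
Lemma cnorm_pi u : cnorm (cpi u) = lnorm u.
Proof.
have /cpi_eq h : cpi (repr (cpi u)) = cpi u by exact: cpi_repr.
apply/le_anti/andP; split.
  by rewrite -[X in lnorm X <= _](subrK u) (le_trans (lnormD _ _))// h add0r.
rewrite -[X in lnorm X <= _](subrK (repr (cpi u))) (le_trans (lnormD _ _))//.
by rewrite -opprB lnormN h add0r.
Qed.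

Lemma cnormD y z : cnorm (y + z) <= cnorm y + cnorm z.
Proof. by rewrite -(cpi_repr z) -(cpi_repr y) -cpiD !cnorm_pi; exact: lnormD. Qed.

Lemma cnormZ a z : cnorm (a *: z) = `|a| * cnorm z.
Proof. by rewrite -(cpi_repr z) cpiZE !cnorm_pi; exact: lnormZ. Qed.

Lemma cnorm_eq0 z : cnorm z = 0 -> z = 0.
Proof.
rewrite -(cpi_repr z) cnorm_pi => h.
have -> : 0 = cpi 0.
  by apply: (addrI (cpi 0)); rewrite addr0 -cpiD addr0.
by apply/cpi_eq; rewrite subr0.
Qed.
HB.instance Definition _ := Lmodule_isNormed.Build R completion cnormD cnormZ cnorm_eq0.

Lemma const_cauchy (v : V) : (fun=> v) \in cauchy_pred.
Proof. by apply/asboolP => e e0; exists 0%N => m n _ _; rewrite subrr snorm0. Qed.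
Definition cembed (v : V) : completion := cpi (Cseq (const_cauchy v)).
Lemma cembed_linear : linear cembed.
Proof.
move=> a u v; rewrite /cembed cpiZE -cpiD; congr cpi; exact: val_inj.
Qed.
HB.instance Definition _ := GRing.isLinear.Build R V completion _ cembed cembed_linear.

Lemma cembed_norm v : `|cembed v| = p v.
Proof.
rewrite [LHS]cnorm_pi.
apply: (cvg_unique _ (@lnorm_cvg _)); [exact: Rhausdorff | move=> /=; exact: (@cvg_cst R)].
Qed.

Lemma cembed_approx (u : cseq) (e : R) : 0 < e ->
  exists k, forall n, (k <= n)%N -> `|cpi u - cembed (cval u n)| < e.
Proof.
move=> e0; have e20 : 0 < e / 2 by rewrite divr_gt0.
have [k hk] := cseqP u e20; exists k => n kn.
have -> : cpi u - cembed (cval u n) = cpi (u - Cseq (const_cauchy (cval u n))).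
  by rewrite cpiD; congr (_ + _); rewrite -scaleN1r cpiZE scaleN1r.
rewrite [ltLHS]cnorm_pi; apply: (@le_lt_trans _ _ (e / 2)); last by lra.
have h : (fun _ : nat => e / 2) @ \oo --> e / 2 by exact: (@cvg_cst R).
apply: (ler_cvg_to (@lnorm_cvg _) h).
by exists k => // m /= km; apply/ltW/hk.
Qed.

Lemma cembed_dense : dense (range cembed).
Proof.
move=> O [z Oz] oO.
have /nbhs_ballP[e /= e0 he] := open_nbhs_nbhs (conj oO Oz).
have [k /(_ k (leqnn _)) hk] := cembed_approx (repr z) e0.
exists (cembed (cval (repr z) k)); split; last by exists (cval (repr z) k).
by apply: he; rewrite -ball_normE /=; rewrite cpi_repr in hk.
Qed.

Lemma completion_complete (F : set_system completion) :
  ProperFilter F -> cauchy F -> cvg F.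
Proof.
move=> FF cF0; have cF : cauchy_ex F by exact: (cauchyP F).1.
have /choice[v hv] : forall n : nat, exists v : V, F (ball (cembed v) (n.+1%:R^-1)).
  move=> n; have n0 : 0 < (n.+1%:R^-1 : R) by rewrite invr_gt0.
  have [z Fz] := cF _ (half_gt0 n0).
  have [k /(_ k (leqnn _)) hk] := cembed_approx (repr z) (half_gt0 n0).
  exists (cval (repr z) k); apply: filterS Fz => y zy.
  rewrite (splitr n.+1%:R^-1); apply: ball_triangle zy.
  by apply: ball_sym; rewrite -ball_normE /=; rewrite cpi_repr in hk.
have small (e : R) : 0 < e -> exists k : nat, forall n, (k <= n)%N -> (n.+1%:R^-1 : R) < e.
  move=> e0; exists (Num.truncn e^-1) => n kn.
  rewrite invf_plt ?posrE //; apply: (lt_le_trans (truncnS_gt _)).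
  by rewrite ler_nat ltnS.
have cv : v \in cauchy_pred.
  apply/asboolP => e e0; have [k hk] := small _ (half_gt0 e0).
  exists k => m n km kn.
  rewrite -cembed_norm linearB /=.
  have [y [ym yn]] := filter_ex (filterI (hv m) (hv n)).
  move: ym yn; rewrite -!ball_normE /= => ym yn.
  apply: (le_lt_trans (ler_distD y _ _)); rewrite (splitr e) (distrC y).
  by apply: ltrD; [exact: lt_trans ym (hk _ km) | exact: lt_trans yn (hk _ kn)].
apply/cvg_ex; exists (cpi (Cseq cv)); apply/cvg_ballP => e e0.
have e20 := half_gt0 e0.
have [k1 h1] := cembed_approx (Cseq cv) e20.
have [k2 h2] := small _ e20.
have := hv (maxn k1 k2); apply: filterS => y hy.
rewrite (splitr e); apply: (@ball_triangle _ _ (cembed (v (maxn k1 k2)))).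
  by rewrite -ball_normE /=; apply: h1; rewrite leq_maxl.
by apply: le_ball hy; apply/ltW/h2; rewrite leq_maxr.
Qed.
HB.instance Definition _ := Uniform_isComplete.Build completion completion_complete.

Lemma completion_exists :
  exists (Z : completeNormedModType R) (iota : {linear V -> Z}),
    is_completion p iota.
Proof. by exists completion, cembed; split; [exact: cembed_norm | exact: cembed_dense]. Qed.

End Completion.

Section PSym.
Context {R : realType} (X : completeNormedModType R) (N : nat).
Implicit Types u v : sym_tensor X N.
Local Notation cost s := (\sum_(p <- s) `|p.1| * `|p.2| ^+ N).
Local Notation S u := [set cost s | s in [set s : seq (R * X) | val u = power_sum N s]].

Lemma S_ex u : S u !=set0.
Proof. by have /asboolP[s hs] := valP u; exists (cost s), s. Qed.

Lemma cost_ge0 (s : seq (R * X)) : 0 <= cost s.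
Proof. by apply: sumr_ge0 => i _; rewrite mulr_ge0 ?exprn_ge0. Qed.

Lemma S_lb u : has_lbound (S u).
Proof. by exists 0 => _ [s _ <-]; exact: cost_ge0. Qed.

Lemma le_cost u s : val u = power_sum N s -> proj_sym_norm u <= cost s.
Proof. by move=> h; apply: ge_inf; [exact: S_lb | exists s]. Qed.

Lemma ge_cost u c : (forall s, val u = power_sum N s -> c <= cost s) ->
  c <= proj_sym_norm u.
Proof. by move=> h; apply: lb_le_inf; [exact: S_ex|move=> _ [s hs <-]; exact: h]. Qed.

Lemma psD u v : proj_sym_norm (u + v) <= proj_sym_norm u + proj_sym_norm v.
Proof.
rewrite -lerBlDr; apply: ge_cost => s hs; rewrite lerBlDr [leRHS]addrC -lerBlDr.
apply: ge_cost => t ht; rewrite lerBlDr -big_cat /=; apply: le_cost.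
by rewrite /power_sum big_cat raddfD /= hs ht addrC.
Qed.

Lemma psZ_le a u : proj_sym_norm (a *: u) <= `|a| * proj_sym_norm u.
Proof.
have H s : val u = power_sum N s -> proj_sym_norm (a *: u) <= `|a| * cost s.
  move=> hs; apply: le_trans (le_cost (s := [seq (a * p.1, p.2) | p <- s]) _) _.
    rewrite linearZ /= hs /power_sum big_map scaler_sumr.
    by apply: eq_bigr => p _; rewrite scalerA.
  rewrite big_map mulr_sumr ler_sum // => p _ /=; by rewrite normrM mulrA.
have [->|a0] := eqVneq a 0.
  rewrite scale0r normr0 mul0r; apply: le_trans (le_cost (s := [::]) _) _.
    by rewrite /power_sum big_nil.
  by rewrite big_nil.
rewrite mulrC -ler_pdivrMr ?normr_gt0 //; apply: ge_cost => s /H.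
by rewrite ler_pdivrMr ?normr_gt0 // mulrC.
Qed.

Lemma psZ a u : proj_sym_norm (a *: u) = `|a| * proj_sym_norm u.
Proof.
apply/le_anti; rewrite psZ_le /=.
have [->|a0] := eqVneq a 0.
  by rewrite normr0 mul0r; apply: ge_cost => s _; exact: cost_ge0.
have := psZ_le a^-1 (a *: u); rewrite scalerA mulVf // scale1r normfV.
by rewrite mulrC ler_pdivlMr ?normr_gt0 // mulrC.
Qed.

Lemma proj_sym_tensor_exists :
  exists (Z : completeNormedModType R) (iota : {linear sym_tensor X N -> Z}),
    is_proj_sym_tensor iota.
Proof. exact: (completion_exists (Seminorm psD psZ)). Qed.

End PSym.

End Existence.

(* Main.v *)
(* By Ryan's theorem, forms on a space with the Dunford-Pettis property are weakly
   sequentially continuous, hence so is the polynomial P(z) = f(z^N) attached to a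
   functional f on the tensor product.  A slice given by f contains e x^N for some
   unit vector x and some sign e; if (y_n) is the weakly null sequence given by weak
   almost squareness at x, then P(x + y_n) and P(x - y_n) tend to P(x), so the
   normalizations of e (x + y_n)^N and e (x - y_n)^N eventually lie in the slice.
   They are almost at distance 2: if x* norms x and y_n* norms y_n, then x*(y_n) and
   y_n*(x) tend to 0, so that the contractive polynomial z |-> x*(z)^(N-1) y_n*(z)
   is close to 1 at x + y_n and close to -1 at x - y_n. *)
Require Import Defs.
From HB Require Import structures.
From mathcomp Require Import all_boot all_order all_algebra.
From mathcomp Require Import all_classical all_reals all_analysis.
From mathcomp Require Import lra.

Import Order.TTheory GRing.Theory Num.Theory.
Import numFieldNormedType.Exports.

Local Open Scope classical_set_scope.
Local Open Scope ring_scope.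

(** * The Hahn-Banach theorem *)

Definition sublinear {R : realType} {X : lmodType R} (p : X -> R) :=
  (forall x y, p (x + y) <= p x + p y) /\
  (forall a x, 0 <= a -> p (a *: x) = a * p x).

Section MinimalSublinear.
Context {R : realType} {X : lmodType R}.
Implicit Types p q : X -> R.

Lemma sublinear0 {p} : sublinear p -> p 0 = 0.
Proof. by move=> [_ /(_ 0 0 (lexx _))]; rewrite scale0r mul0r. Qed.

Lemma sublinearN {p} : sublinear p -> forall x, - p (- x) <= p x.
Proof.
move=> sp x; have := sp.1 x (- x).
rewrite subrr (sublinear0 sp); lra.
Qed.

(* The largest sublinear q <= p with q (- y) <= - p y. A minimal sublinear function
   agrees with all its tilts, which makes it superadditive, hence linear. *)
Definition tilt p y x := inf [set p (x + t *: y) - t * p y | t in [set t | 0 <= t]].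

(** Subadditivity for [(x + t *: y) + (- x) = t *: y]; this keeps the infimum in [tilt] finite. *)
Lemma tilt_lbound {p} y x t : sublinear p -> 0 <= t ->
  - p (- x) <= p (x + t *: y) - t * p y.
Proof.
move=> sp t0; have := sp.1 (x + t *: y) (- x).
rewrite addrAC subrr add0r sp.2 //; lra.
Qed.

Lemma tilt_le {p} y x t : sublinear p -> 0 <= t ->
  tilt p y x <= p (x + t *: y) - t * p y.
Proof.
move=> sp t0; apply: ge_inf; last by exists t.
by exists (- p (- x)) => _ [s s0 <-]; exact: tilt_lbound.
Qed.

Lemma le_tilt p y x c :
  (forall t, 0 <= t -> c <= p (x + t *: y) - t * p y) -> c <= tilt p y x.
Proof.
move=> h; apply: lb_le_inf => [|_ [t t0 <-]]; last exact: h.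
by exists (p (x + 0 *: y) - 0 * p y); exists 0 => //=.
Qed.

Lemma tilt_le_id {p} y x : sublinear p -> tilt p y x <= p x.
Proof.
move=> sp; apply: (le_trans (tilt_le y x 0 sp (lexx _))).
by rewrite scale0r addr0 mul0r subr0.
Qed.

Lemma tilt_sublinear {p} y : sublinear p -> sublinear (tilt p y).
Proof.
move=> sp; split=> [u v|a x].
  rewrite -lerBlDr; apply: le_tilt => s s0.
  rewrite lerBlDr -lerBlDl; apply: le_tilt => t t0.
  rewrite lerBlDl; apply: (le_trans (tilt_le y _ (s + t) sp (addr_ge0 s0 t0))).
  have := sp.1 (u + s *: y) (v + t *: y).
  rewrite addrACA -scalerDl; lra.
(* One inequality for all positive scalars suffices: the reverse one follows with [a^-1]. *)
have pos b z : 0 < b -> tilt p y (b *: z) <= b * tilt p y z.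
  move=> b0; rewrite mulrC -ler_pdivrMr //; apply: le_tilt => t t0.
  rewrite ler_pdivrMr //.
  have := tilt_le y (b *: z) (b * t) sp (mulr_ge0 (ltW b0) t0).
  by rewrite -scalerA -scalerDr (sp.2 _ _ (ltW b0)) -mulrA -mulrBr [b * (_ - _)]mulrC.
rewrite le_eqVlt => /orP[/eqP <-|a0].
  rewrite scale0r mul0r; apply/le_anti/andP; split.
    by rewrite -(sublinear0 sp) tilt_le_id.
  by apply: le_tilt => t t0; rewrite add0r sp.2 // subrr.
apply/le_anti/andP; split; first exact: pos.
have := pos a^-1 (a *: x); rewrite invr_gt0 scalerA mulVf ?gt_eqF // scale1r.
by move=> /(_ a0); rewrite mulrC ler_pdivlMr // mulrC.
Qed.

(** Zorn's lemma for the reversed pointwise order. A nonempty chain is bounded by its pointwise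
    infimum, which is finite because every member is at least [- p (- x)] at [x]. *)
Lemma minimal_sublinear p : sublinear p -> exists q,
  [/\ sublinear q, forall x, q x <= p x &
      forall r, sublinear r -> (forall x, r x <= q x) -> r = q].
Proof.
move=> sp; pose T := {q : X -> R | sublinear q /\ forall x, q x <= p x}.
pose le (q r : T) := `[< forall x, sval r x <= sval q x >].
have [|q r s /asboolP qr /asboolP rs|q r /asboolP qr /asboolP rq|A tA|] :=
    @Zorn T le.
- by move=> q; apply/asboolP => x.
- by apply/asboolP => x; apply: le_trans (qr x).
- have : sval q = sval r by apply/funext => x; apply/le_anti; rewrite qr rq.
  by case: q r {qr rq} => q hq [r hr] /= qr; subst r; congr exist.
- have [[q0 Aq0]|A0] := pselect (A !=set0); last first.
    exists (exist _ p (conj sp (fun=> lexx _))) => s As.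
    by case: A0; exists s.
  pose S x := [set sval s x | s in A].
  have lb x : has_lbound (S x).
    exists (- p (- x)) => _ [[s [ss sle]] As <-] /=.
    by apply: le_trans (sublinearN ss x); rewrite lerN2.
  have ne x : S x !=set0 by exists (sval q0 x), q0.
  pose q x := inf (S x).
  have q_le s x : A s -> q x <= sval s x by move=> As; apply: ge_inf => //; exists s.
  have le_q c x : (forall s, A s -> c <= sval s x) -> c <= q x.
    by move=> h; apply: lb_le_inf => // _ [s As <-]; exact: h.
  have sq : sublinear q.
    split=> [x y|a x a0].
      rewrite -lerBlDr; apply: (le_q) => s As; rewrite lerBlDr -lerBlDl.
      apply: (le_q) => t At; rewrite lerBlDl.
      (* Of the two chain members, the smaller one serves for both arguments. *)
      have [/asboolP h|/asboolP h] := tA _ _ As At.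
        apply: (le_trans (q_le _ _ At)); apply: (le_trans ((svalP t).1.1 x y)).
        by rewrite lerD2r.
      apply: (le_trans (q_le _ _ As)); apply: (le_trans ((svalP s).1.1 x y)).
      by rewrite lerD2l.
    have h b z : 0 < b -> q (b *: z) <= b * q z.
      move=> b0; rewrite mulrC -ler_pdivrMr //; apply: (le_q) => s As.
      rewrite ler_pdivrMr // mulrC -((svalP s).1.2 _ _ (ltW b0)); exact: q_le.
    move: a0; rewrite le_eqVlt => /orP[/eqP <-|a0].
      rewrite scale0r mul0r; apply/le_anti/andP; split.
        by apply: (le_trans (q_le _ _ Aq0)); rewrite (sublinear0 (svalP q0).1).
      by apply: (le_q) => s As; rewrite (sublinear0 (svalP s).1).
    apply/le_anti/andP; split; first exact: h.
    have := h a^-1 (a *: x); rewrite invr_gt0 scalerA mulVf ?gt_eqF // scale1r.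
    by move=> /(_ a0); rewrite mulrC ler_pdivlMr // mulrC.
  have qp x : q x <= p x by apply: (le_trans (q_le _ x Aq0)); exact: (svalP q0).2.
  by exists (exist _ q (conj sq qp)) => s As; apply/asboolP => x; exact: q_le.
move=> [q [sq qp]] qmin; exists q; split=> // r sr rq.
have rp x : r x <= p x by apply: le_trans (qp x).
have /qmin/(congr1 sval) : le (exist _ q (conj sq qp)) (exist _ r (conj sr rp)).
  by apply/asboolP.
exact.
Qed.

Lemma sublinear_dominates_linear p : sublinear p ->
  exists f : {linear X -> R^o}, forall x, f x <= p x.
Proof.
move=> /minimal_sublinear[q [sq qp qmin]].
have qD x y : q (x + y) = q x + q y.
  apply/le_anti; rewrite sq.1 /=.
  (* By minimality [tilt q y] is [q], so the bound at t = 1 reads q x <= q (x + y) - q y. *)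
  have := tilt_le y x 1 sq ler01.
  rewrite (qmin _ (tilt_sublinear y sq) (fun x => tilt_le_id y x sq)).
  rewrite scale1r mul1r; lra.
have qN x : q (- x) = - q x.
  by apply: (addrI (q x)); rewrite -qD !subrr (sublinear0 sq).
have ql : linear (q : X -> R^o).
  move=> a x y; rewrite qD; congr (_ + _).
  have [a0|/ltW a0] := leP 0 a; first by rewrite sq.2.
  by rewrite -[a]opprK scaleNr qN sq.2 ?oppr_ge0 // [RHS]scaleNr.
pose F := GRing.isLinear.Build R X R^o _ q ql.
by exists (HB.pack_for {linear X -> R^o} q F).
Qed.

End MinimalSublinear.

(** A linear functional below the norm tilted at [x] is below the norm, and its value at [- x] is at
    most |- x + x| - |x| = - |x|. *)
Lemma norming_functional {R : realType} {X : normedModType R} (x : X) :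
  exists f : {linear X -> R^o}, (forall z, `|f z| <= `|z|) /\ f x = `|x|.
Proof.
have sn : sublinear (fun z : X => `|z|).
  by split=> [|a z a0]; [exact: ler_normD | rewrite normrZ ger0_norm].
have [f hf] := sublinear_dominates_linear _ (tilt_sublinear x sn).
have fle z : f z <= `|z| by apply: (le_trans (hf z)); exact: tilt_le_id.
exists f; split=> [z|].
  rewrite ler_norml fle andbT lerNl -linearN.
  by rewrite -[leRHS]normrN fle.
apply/le_anti; rewrite fle /=.
have := le_trans (hf (- x)) (tilt_le x (- x) 1 sn ler01).
by rewrite scale1r addNr normr0 mul1r sub0r linearN lerN2.
Qed.

(** * Weak compactness *)

(** A filter on the closure of the image need not live on the image itself, but its open members
    meet the image. Their preimages generate a filter on [B]; regularity turns the limit along a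
    finer ultrafilter into a cluster point of the original filter. *)
Lemma precompact_image_ultra {I : Type} {T : topologicalType} (f : I -> T)
    (B : set I) : regular_space T ->
  (forall F : set_system I, UltraFilter F -> F B -> exists y : T, f @ F --> y) ->
  precompact (f @` B).
Proof.
move=> regT fB; rewrite precompactE => G FG GB.
pose D := [set U : set T | open U /\ G U].
have FF : ProperFilter (filter_from D (fun U => B `&` f @^-1` U)).
  apply: filter_from_proper => [|U [oU GU]].
    apply: filter_from_filter; first by exists setT; split; [exact: openT|exact: filterT].
    move=> U V [oU GU] [oV GV]; exists (U `&` V).
      by split; [exact: openI|exact: filterI].
    by move=> x [Bx [Ux Vx]].
  have [z [clz Uz]] := filter_ex (filterI GB GU).
  have [_ [[x Bx <-] Ux]] := clz U (open_nbhs_nbhs (conj oU Uz)).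
  by exists x.
have [F [uF sF]] := ultraFilterLemma FF.
have FB : F B.
  apply: sF; exists setT; first by split; [exact: openT|exact: filterT].
  by move=> x [].
have [y Fy] := fB F uF FB.
exists y; split.
  move=> W /Fy FW; have {}FW : F (f @^-1` W) := FW.
  by have [x [Bx Wx]] := filter_ex (filterI FB FW); exists (f x); split => //; exists x.
move=> C W GC /regT[V Vy clVW]; apply: contrapT => CW.
have /sF Fn : filter_from D (fun U => B `&` f @^-1` U) (f @^-1` ~` closure V).
  exists (~` closure V); last by move=> x [].
  split; first exact/closed_openC/closed_closure.
  by apply: filterS GC => z Cz clz; apply: CW; exists z; split => //; exact: clVW.
have [x [nV Vx]] := filter_ex (filterI Fn (Fy _ Vy : F (f @^-1` V))).
by apply: nV; exact: subset_closure.
Qed.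

(** Unfolding [weak] to the initial topology exposes a uniform structure, and uniform spaces are
    regular. *)
Lemma weak_regular {R : realType} (Y : normedModType R) : regular_space (weak Y).
Proof.
exact: (@uniform_regular (initial_topology
  (fun (x : Y) => (fun f : dual Y => f x) : {ptws dual Y -> R}))).
Qed.

(** One direction of [weak_cvgP] for general filters, for use with ultrafilters. *)
Lemma weak_cvg_filter {R : realType} {Y : normedModType R} {I : Type}
    (F : set_system I) (u : I -> Y) (y : Y) : Filter F ->
  (forall f : dual Y, f (u i) @[i --> F] --> f y) ->
  (u : I -> weak Y) @ F --> (y : weak Y).
Proof.
move=> FF uy; pose j : weak Y -> {ptws dual Y -> R} := fun x f => f x.
have ju : (j \o u) @ F --> j y.
  apply/cvg_sup => f A.
  rewrite (@nbhsE (initial_topology (@proj (dual Y) (fun=> R) f))).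
  move=> [B [[C oC <-] /= Cx] sB].
  apply: filterS sB _; apply: (uy f); exact: open_nbhs_nbhs.
move=> A; rewrite (@nbhsE (weak Y)) => -[B [[C oC <-] /= Cx] sB].
by apply: filterS sB _; apply: ju; exact: open_nbhs_nbhs.
Qed.

(** * Null sequences *)

Definition null_seq_pred {R : realType} : {pred nat -> R^o} :=
  fun u => `[< u @ \oo --> (0 : R) >].

Lemma null_seq_submod {R : realType} : submod_closed (@null_seq_pred R).
Proof.
split=> [|a u v /asboolP u0 /asboolP v0]; apply/asboolP; first exact: (@cvg_cst R).
have := @cvgD _ R _ _ _ _ _ _ _ (cvgMl_tmp (a := a) u0) v0.
rewrite mulr0 addr0. exact.
Qed.

HB.instance Definition _ (R : realType) :=
  GRing.isSubmodClosed.Build R _ (@null_seq_pred R) (@null_seq_submod R).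

Record null_seq (R : realType) :=
  NullSeq { null_val : nat -> R^o ; null_valP : null_val \in @null_seq_pred R }.
Arguments null_val {R}.
Arguments null_valP {R}.

HB.instance Definition _ (R : realType) := [isSub for @null_val R].
HB.instance Definition _ (R : realType) := [Choice of null_seq R by <:].
HB.instance Definition _ (R : realType) :=
  [SubChoice_isSubLmodule of null_seq R by <:].

Section NullSequences.
Context {R : realType}.
Implicit Types z : null_seq R.

Lemma null_cvg z : null_val z @ \oo --> (0 : R).
Proof. by have /asboolP := null_valP z. Qed.

Definition sup_norm z : R := sup (range (fun n => `|null_val z n|)).

Lemma le_sup_norm z n : `|null_val z n| <= sup_norm z.
Proof.
apply: sup_ubound; last by exists n.
have [M hM] : bounded_fun (null_val z : nat -> R).
  by apply: cvg_seq_bounded; apply/cvg_ex; exists 0; exact: null_cvg.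
by exists (M + 1) => _ [k _ <-]; apply: hM.2 => //; rewrite ltrDl.
Qed.

Lemma sup_norm_le z M : (forall n, `|null_val z n| <= M) -> sup_norm z <= M.
Proof.
by move=> zM; apply: ge_sup => [|_ [n _ <-]]; [exists `|null_val z 0|, 0|exact: zM].
Qed.

Lemma sup_norm_ge0 z : 0 <= sup_norm z.
Proof. exact: le_trans (le_sup_norm z 0). Qed.

Lemma sup_normD z1 z2 : sup_norm (z1 + z2) <= sup_norm z1 + sup_norm z2.
Proof.
apply: sup_norm_le => n; apply: (le_trans (ler_normD _ _)).
by rewrite lerD ?le_sup_norm.
Qed.

Lemma sup_normZ a z : sup_norm (a *: z) = `|a| * sup_norm z.
Proof.
have le b y : sup_norm (b *: y) <= `|b| * sup_norm y.
  by apply: sup_norm_le => n; rewrite [leLHS]normrM ler_wpM2l ?le_sup_norm.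
have [->|a0] := eqVneq a 0.
  apply/le_anti; rewrite le /= normr0 mul0r; exact: sup_norm_ge0.
apply/le_anti; rewrite le /= mulrC -ler_pdivlMr ?normr_gt0 //.
by have := le a^-1 (a *: z); rewrite scalerA mulVf // scale1r normfV mulrC.
Qed.

(** Completing c_0 for this seminorm gives a Banach space that contains c_0 isometrically and can be
    the target of an operator in the Dunford-Pettis property. *)
Definition sup_seminorm := Existence.Seminorm sup_normD sup_normZ.

Lemma unit_seq_subproof k : (fun n => (n == k)%:R : R^o) \in @null_seq_pred R.
Proof.
apply/asboolP; apply: cvg_near_cst.
by exists k.+1 => // n /= kn; rewrite gtn_eqF.
Qed.

Definition unit_seq k := NullSeq R _ (unit_seq_subproof k).

Lemma null_val_sum m (c : nat -> R) n :
  null_val (\sum_(k < m) c k *: unit_seq k) n = if (n < m)%N then c n else 0.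
Proof.
have -> : null_val (\sum_(k < m) c k *: unit_seq k) n
    = \sum_(k < m) c k * (n == k)%:R.
  rewrite -[null_val _]/(\val _) raddf_sum fct_sumE.
  by apply: eq_bigr => k _.
case: ifPn => [nm|]; last first.
  rewrite -leqNgt => mn; rewrite big1 // => k _.
  by rewrite gtn_eqF ?mulr0 // (leq_trans (ltn_ord k)).
rewrite (bigD1 (Ordinal nm)) //= eqxx mulr1 big1 ?addr0 // => k.
by rewrite eq_sym -val_eqE /= => /negPf ->; rewrite mulr0.
Qed.

(* The coefficients of a bounded functional on c_0 are summable, hence have
   small tails. *)
Lemma null_functional_tail (g : {linear null_seq R -> R^o}) C :
    (forall z, `|g z| <= C * sup_norm z) ->
  forall e, 0 < e -> exists m, forall z,
    `|g z| <= \sum_(k < m) `|g (unit_seq k)| * `|null_val z k| + e * sup_norm z.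
Proof.
move=> gC e e0; pose a (k : nat) : R := g (unit_seq k).
pose s (m : nat) : R := \sum_(k < m) `|a k|.
have gsum m (c : nat -> R) :
    g (\sum_(k < m) c k *: unit_seq k) = \sum_(k < m) c k * a k.
  by rewrite raddf_sum /=; apply: eq_bigr => k _; rewrite linearZ.
have C0 : 0 <= C.
  have := le_trans (normr_ge0 _) (gC (unit_seq 0)).
  apply: contraLR; rewrite -!ltNge => C0; rewrite nmulr_rlt0 //.
  by apply: lt_le_trans (le_sup_norm _ 0); rewrite /= normr1.
have sC m : s m <= C.
  (* Testing [g] on the signs of its coefficients, a sequence of norm at most 1, bounds the partial
     sums by [C]. *)
  have -> : s m = g (\sum_(k < m) Num.sg (a k) *: unit_seq k).
    rewrite (gsum m (fun k => Num.sg (a k))).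
    by apply: eq_bigr => k _; rewrite normrEsg.
  apply: (le_trans (ler_norm _)); apply: (le_trans (gC _)).
  rewrite ler_piMr //; apply: sup_norm_le => n.
  rewrite (null_val_sum m (fun k => Num.sg (a k))).
  by case: ifP => _; rewrite ?normr0 ?normr_sg ?ler01 //; case: (_ == 0).
have hs : has_sup (range s) by split; [exists (s 0), 0 | exists C => _ [m _ <-]].
(* Past this [m] the absolute values of the coefficients sum to at most [e]. *)
have [_ [m _ <-] sm] := sup_adherent e0 hs.
exists m => z; apply/ler_addgt0Pr => d d0.
have dC : 0 < d / (C + 1) by rewrite divr_gt0 // ltr_wpDl.
have [M' _ hM'] := (@cvgr0_norm_le _ _ _ _ _ _ (null_cvg z)) _ dC.
(* Truncating [z] at [M] costs at most C * (d / (C + 1)) <= d under [g]. *)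
pose M := (m + M')%N.
have hM n : (M <= n)%N -> `|null_val z n| <= d / (C + 1).
  by move=> Mn; apply: hM'; rewrite /= (leq_trans _ Mn) // leq_addl.
pose t := \sum_(k < M) null_val z k *: unit_seq k.
have tail : `|g (z - t)| <= d.
  apply: (le_trans (gC _)); apply: (@le_trans _ _ (C * (d / (C + 1)))).
    rewrite ler_wpM2l //; apply: sup_norm_le => n.
    have -> : null_val (z - t) n = null_val z n - null_val t n by [].
    rewrite (null_val_sum M (null_val z)); case: ltnP => [_|/hM]; last by rewrite subr0.
    by rewrite subrr normr0 ltW.
  by rewrite mulrCA ler_piMr ?(ltW d0) // ler_pdivrMr ?mul1r ?lerDl // ltr_wpDl.
have body : `|g t| <= \sum_(k < m) `|a k| * `|null_val z k| + e * sup_norm z.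
  rewrite (gsum M (null_val z)); apply: (le_trans (ler_norm_sum _ _ _)).
  rewrite -(big_mkord xpredT (fun k => `|null_val z k * a k|)).
  rewrite (@big_cat_nat _ _ _ m) ?leq_addr //= big_mkord lerD //.
    by apply: ler_sum => k _; rewrite normrM mulrC.
  apply: (@le_trans _ _ (\sum_(m <= k < M) `|a k| * sup_norm z)).
    by apply: ler_sum => k _; rewrite normrM mulrC ler_wpM2l ?le_sup_norm.
  rewrite -mulr_suml ler_wpM2r ?sup_norm_ge0 //.
  have : s M <= sup (range s) by apply: sup_ubound; [exact: hs.2|exists M].
  rewrite /s -[X in X <= _](big_mkord xpredT (fun k => `|a k|)).
  rewrite (@big_cat_nat _ _ _ m) ?leq_addr //= big_mkord -/(s m); lra.
rewrite -[z in leLHS](subrK t) linearD.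
by apply: (le_trans (ler_normD _ _)); rewrite addrC lerD.
Qed.

End NullSequences.

(** * Sequences in spaces with the Dunford-Pettis property *)

Lemma linear_le_continuous {R : realType} {X Y : normedModType R}
  (f : {linear X -> Y}) (C : R) : (forall x, `|f x| <= C * `|x|) -> continuous f.
Proof.
move=> fC; apply: bounded_linear_continuous; apply/linear_boundedP.
exists C; split; first exact: num_real.
move=> r Cr x; apply: (le_trans (fC x)); rewrite ler_wpM2r //; exact: ltW.
Qed.

Lemma dual_le {R : realType} {X : normedModType R} (f : dual X) :
  exists C, forall x, `|f x| <= C * `|x|.
Proof.
have /linear_bounded_continuous/linear_boundedP[C [_ fC]] := svalP f.
by exists (C + 1) => x; apply: fC; rewrite ltrDl.
Qed.

(** Compactness of [-M, M] gives a cluster point, and a cluster point of an ultrafilter is a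
    limit. *)
Lemma ultra_bounded_cvg {R : realType} {I : Type} (F : set_system I)
    (B : set I) (u : I -> R) (M : R) : UltraFilter F -> F B ->
  (forall i, B i -> `|u i| <= M) -> exists l : R, u @ F --> l.
Proof.
move=> uF FB uM; have FM : F (u @^-1` `[- M, M]).
  by apply: filterS FB => i /uM; rewrite /= in_itv /= ler_norml.
have [l [_ ul]] := @segment_compact R (- M) M (u @ F) _ FM.
exists l => W Wl; have [//|FW] := in_ultra_setVsetC (u @^-1` W) uF.
by have [y []] := ul (~` W) W FW Wl.
Qed.

Section SequentialDunfordPettis.
Context {R : realType} {X : completeNormedModType R}.
Variables (phi : nat -> {linear X -> R^o}) (M : R).
Hypothesis phiM : forall n x, `|phi n x| <= M * `|x|.
Hypothesis phi0 : forall x, phi n x @[n --> \oo] --> (0 : R).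
(* This says that phi n --> 0 weakly in the dual of X: by Goldstine's theorem,
   functionals in the unit ball of the bidual are such limits of points of X. *)
Hypothesis phi_weak0 : forall (F : set_system X) (l : nat -> R),
  UltraFilter F -> F (unit_ball X) ->
  (forall n, phi n x @[x --> F] --> l n) -> l @ \oo --> (0 : R).

Context {Y : completeNormedModType R} {iota : {linear null_seq R -> Y}}.
Hypothesis iota_norm : forall z, `|iota z| = sup_norm z.

Lemma eval_null_subproof x : (fun n => phi n x) \in @null_seq_pred R.
Proof. exact/asboolP. Qed.

Definition eval_null x : null_seq R := NullSeq R _ (eval_null_subproof x).

Fact eval_null_linear : linear eval_null.
Proof.
by move=> a x y; apply: val_inj; apply/funext => n; rewrite /= linearP.
Qed.

HB.instance Definition _ :=
  GRing.isLinear.Build R X (null_seq R) _ eval_null eval_null_linear.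

Let T : {linear X -> Y} := iota \o eval_null.

Let T_le x : `|T x| <= M * `|x|.
Proof. by rewrite iota_norm; apply: sup_norm_le => n; exact: phiM. Qed.

(** Along an ultrafilter on the unit ball the coordinates of [T x] converge, and [phi_weak0] puts
    the limit sequence in c_0. The convergence is weak, since up to a small error a functional on
    c_0 sees only finitely many coordinates. *)
Lemma T_weakly_compact : weakly_compact_operator T.
Proof.
split; first exact: linear_le_continuous T_le.
apply: precompact_image_ultra; first exact: weak_regular.
move=> F uF FB.
have /choice[l phil] : forall n, exists l : R, phi n x @[x --> F] --> l.
  move=> n; apply: (@ultra_bounded_cvg _ _ _ _ _ `|M| uF FB) => x xB.
  apply: (le_trans (phiM n x)); rewrite -[leRHS]mulr1.
  by apply: (@le_trans _ _ (`|M| * `|x|)); rewrite ?ler_wpM2r ?ler_wpM2l ?ler_norm.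
have l0 : (l : nat -> R^o) \in @null_seq_pred R.
  by apply/asboolP; exact: (phi_weak0 F).
pose z := NullSeq R l l0.
exists (iota z : weak Y).
apply: weak_cvg_filter => f.
have [C fC] := dual_le f.
pose g : {linear null_seq R -> R^o} := sval f \o iota.
have gC w : `|g w| <= C * sup_norm w.
  by apply: (le_trans (fC _)); rewrite iota_norm.
apply/cvgrPdist_le => e e0.
(* [K] bounds the sup norm of [z - eval_null x] over the unit ball, so the tail costs at most e /
   2. *)
pose K := `|M| + sup_norm z + 1.
have K0 : 0 < K by rewrite ltr_wpDl // addr_ge0 ?sup_norm_ge0.
have [m gm] := null_functional_tail g C gC _ (divr_gt0 (Existence.half_gt0 e0) K0).
have h0 : (fun x => \sum_(k < m) `|g (unit_seq k)| * `|l k - phi k x|) @ F --> (0 : R).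
  have E : \sum_(k < m) `|g (unit_seq k)| * `|l k - l k| = 0.
    by rewrite big1 // => k _; rewrite subrr normr0 mulr0.
  rewrite -[X in _ --> X]E; apply: cvg_big => [|k _]; first exact: add_continuous.
  by apply: cvgMl_tmp; apply: cvg_norm; apply: cvgB; [exact: cvg_cst|].
near=> x.
have -> : f (iota z) - f (T x) = g (z - eval_null x).
  by rewrite -[LHS]/(sval f (iota z) - sval f (iota (eval_null x))) -!raddfB.
apply: (le_trans (gm _)).
have xB : unit_ball X x by near: x.
have sK : sup_norm (z - eval_null x) <= K.
  apply: (le_trans (sup_normD _ _)); rewrite -[K]addrA addrCA lerD //.
  rewrite -scaleN1r sup_normZ normrN1 mul1r; apply: sup_norm_le => n.
  apply: (le_trans (phiM n x)); apply: (le_trans (ler_norm _)).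
  by rewrite normrM normr_id (le_trans (ler_piMr _ xB)) // lerDl.
have hx : `|\sum_(k < m) `|g (unit_seq k)| * `|l k - phi k x| | <= e / 2.
  by near: x; exact: (cvgr0_norm_le _ h0 _ (Existence.half_gt0 e0)).
rewrite [leRHS](splitr e) lerD //; first exact: le_trans (ler_norm _) hx.
by rewrite mulrAC ler_pdivrMr // ler_wpM2l // ltW // Existence.half_gt0.
Unshelve. all: by end_near. Qed.

(** |phi n (v n - x)| is at most the norm of T (v n) - T x, a bound uniform over the coordinates
    that tends to 0. *)
Lemma dunford_pettis_seq (v : nat -> X) (x : X) : dunford_pettis X ->
  (v : nat -> weak X) @ \oo --> (x : weak X) -> phi n (v n) @[n --> \oo] --> (0 : R).
Proof.
move=> DP vx; have Tv := DP Y T T_weakly_compact v x vx.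
have := cvgD (cvg_norm (cvgB Tv (cvg_cst (T x)))) (cvg_norm (phi0 x)).
rewrite subrr !normr0 addr0 => h.
apply/norm_cvg0P; apply: squeeze_cvgr; [|exact: cvg_cst|exact: h].
apply: nearW => n; rewrite normr_ge0 /=.
apply: (@le_trans _ _ (`|T (v n) - T x| + `|phi n x|)) => //.
rewrite -lerBlDr -linearB iota_norm.
apply: le_trans (le_sup_norm (eval_null (v n - x)) n).
by rewrite /= linearB lerB_dist.
Qed.

End SequentialDunfordPettis.

(** * Weak continuity of forms *)

Definition fcons {X : Type} {k : nat} (x : X) (u : 'I_k -> X) : 'I_k.+1 -> X :=
  fun i => oapp u x (unlift ord0 i).

Lemma dfwithE {I : eqType} {X : Type} (v : I -> X) i x j :
  dfwith v i x j = if j == i then x else v j.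
Proof.
by case: eqVneq => [->|]; rewrite ?dfwithin // => ji; rewrite dfwithout 1?eq_sym.
Qed.

Section Fcons.
Context {X : Type} {k : nat}.

Lemma fcons0 (x : X) (u : 'I_k -> X) : fcons x u ord0 = x.
Proof. by rewrite /fcons unlift_none. Qed.

Lemma fcons_lift (x : X) (u : 'I_k -> X) i : fcons x u (lift ord0 i) = u i.
Proof. by rewrite /fcons liftK. Qed.

Lemma fcons_eta (u : 'I_k.+1 -> X) : fcons (u ord0) (u \o lift ord0) = u.
Proof. by apply/funext => i; rewrite /fcons; case: unliftP => [j|] ->. Qed.

Lemma fcons_dfwith_lift (x z : X) (u : 'I_k -> X) i :
  fcons x (dfwith u i z) = dfwith (fcons x u) (lift ord0 i) z.
Proof.
apply/funext => j; rewrite !dfwithE /fcons; case: unliftP => [m|] -> //=.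
by rewrite (inj_eq lift_inj) dfwithE.
Qed.

Lemma fcons_dfwith0 (x z : X) (u : 'I_k -> X) :
  fcons z u = dfwith (fcons x u) ord0 z.
Proof.
apply/funext => j; by rewrite dfwithE /fcons; case: unliftP => [m|] -> /=.
Qed.

End Fcons.

(** Boundedness is required on balls of every radius, so that freezing an argument preserves it
    after enlarging the radius. *)
Definition bounded_form {R : realType} {X : normedModType R} {k : nat}
    (A : multiform X k) : Prop :=
  forall M, exists C, forall v, (forall i, `|v i| <= M) -> `|A v| <= C.

Lemma linear_le_unit_ball {R : realType} {X : normedModType R}
    (f : {linear X -> R^o}) (C : R) :
  (forall x, `|x| <= 1 -> `|f x| <= C) -> forall x, `|f x| <= C * `|x|.
Proof.
move=> fC x; have [->|x0] := eqVneq x 0; first by rewrite linear0 !normr0 mulr0.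
rewrite -ler_pdivrMr ?normr_gt0 // mulrC.
have -> : `|x|^-1 * `|f x| = `|f (`|x|^-1 *: x)|.
  by rewrite linearZ normrZ ger0_norm // invr_ge0.
apply: fC; rewrite normrZ normfV normr_id mulVf // normr_eq0 //.
Qed.

Section PartialForms.
Context {R : realType} {X : normedModType R} {k : nat}.
Variable A : multiform X k.+1.

Lemma form_head_linear (u : 'I_k -> X) : linear ((fun x => A (fcons x u)) : X -> R^o).
Proof.
by move=> a x y; rewrite (fcons_dfwith0 0) mform_linear -!(fcons_dfwith0 0).
Qed.

Definition form_head (u : 'I_k -> X) : {linear X -> R^o} :=
  HB.pack (fun x : X => A (fcons x u) : R^o)
    (GRing.isLinear.Build R X R^o _ _ (form_head_linear u)).

Lemma form_tail_linear x (v : 'I_k -> X) i a y z :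
  A (fcons x (dfwith v i (a *: y + z))) =
  a * A (fcons x (dfwith v i y)) + A (fcons x (dfwith v i z)).
Proof. by rewrite !fcons_dfwith_lift mform_linear. Qed.

Definition form_tail x : multiform X k :=
  @Multiform R X k (fun v => A (fcons x v)) (form_tail_linear x).

Hypothesis A_bounded : bounded_form A.

Lemma form_bound (M : R) : exists2 C, 0 <= C & forall x (v : 'I_k -> X), `|x| <= M ->
  (forall i, `|v i| <= M) -> `|A (fcons x v)| <= C.
Proof.
have [C AC] := A_bounded M; exists `|C| => // x v xM vM.
apply: le_trans (ler_norm C); apply: AC => i.
by rewrite /fcons; case: unliftP => [j|] _ /=.
Qed.

Lemma form_tail_bounded x : bounded_form (form_tail x).
Proof.
move=> M; have [C _ AC] := form_bound (Num.max `|x| M).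
exists C => v vM; apply: AC => [|i]; rewrite le_max ?lexx // vM orbT //.
Qed.

Lemma form_head_le (u : 'I_k -> X) M C :
  (forall x (v : 'I_k -> X), `|x| <= Num.max M 1 ->
     (forall i, `|v i| <= Num.max M 1) -> `|A (fcons x v)| <= C) ->
  (forall i, `|u i| <= M) -> forall x, `|form_head u x| <= C * `|x|.
Proof.
move=> AC uM; apply: linear_le_unit_ball => x x1.
by apply: AC => [|i]; rewrite le_max ?x1 ?uM ?orbT.
Qed.

(** The ultrafilter plays the part of a point of the bidual put in the first slot. The values are
    bounded, so limits exist, and they inherit linearity and bounds. *)
Lemma form_ultralimit (F : set_system X) : UltraFilter F -> F (unit_ball X) ->
  exists2 B : multiform X k, bounded_form B &
    forall v, A (fcons x v) @[x --> F] --> B v.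
Proof.
move=> uF FB.
have /choice[L AL] : forall v : 'I_k -> X,
    exists l : R, A (fcons x v) @[x --> F] --> l.
  move=> v; have [C _ AC] := form_bound (Num.max 1 (\sum_i `|v i|)).
  apply: (@ultra_bounded_cvg _ _ _ _ _ C uF FB) => x x1.
  apply: AC => [|i]; first by rewrite le_max x1.
  by rewrite le_max; apply/orP; right; rewrite (bigD1 i) //= lerDl sumr_ge0.
have Llin (v : 'I_k -> X) i a y z :
    L (dfwith v i (a *: y + z)) = a * L (dfwith v i y) + L (dfwith v i z).
  apply: (cvg_unique (@Rhausdorff R) (AL _)) => /=.
  under eq_fun do rewrite form_tail_linear.
  by apply: cvgD => //; apply: cvgMl_tmp.
exists (@Multiform R X k L Llin) => // M.
have [C _ AC] := form_bound (Num.max M 1); exists C => v vM /=.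
apply: (ler_cvg_to (cvg_norm (AL v)) (cvg_cst C)).
apply: filterS FB => x x1.
by apply: AC => [|i]; rewrite le_max ?x1 ?vM ?orbT.
Qed.

End PartialForms.

(* Ryan's theorem. Freezing all arguments but the first, the functionals A(., u_n)
   converge weakly in the dual, because composing A with a functional of the bidual
   yields a form with one argument less. *)
Lemma form_weakly_continuous {R : realType} {X : completeNormedModType R} :
  dunford_pettis X -> forall k (A : multiform X k), bounded_form A ->
  forall (u : nat -> 'I_k -> X) (w : 'I_k -> X) (M : R),
  (forall n i, `|u n i| <= M) ->
  (forall i, (fun n => u n i : weak X) @ \oo --> (w i : weak X)) ->
  A (u n) @[n --> \oo] --> A w.
Proof.
move=> DP; elim=> [|k IH] A bA u w M0 uM0 uw.
  have uE n : u n = w by apply/funext => -[].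
  by under eq_fun do rewrite uE; exact: cvg_cst.
have [M uM wM] : exists2 M, forall n i, `|u n i| <= M & forall i, `|w i| <= M.
  exists (Num.max M0 (\sum_i `|w i|)) => [n|] i; rewrite le_max ?uM0 //.
  by apply/orP; right; rewrite (bigD1 i) //= lerDl sumr_ge0.
pose u' n := u n \o lift ord0; pose w' := w \o lift ord0.
have IHB (B : multiform X k) : bounded_form B -> B (u' n) @[n --> \oo] --> B w'.
  by move=> bB; apply: (IH B bB u' w' M) => [n|] i; [exact: uM | exact: uw].
pose phi n : {linear X -> R^o} := form_head A (u' n) \- form_head A w'.
have [C C0 AC] := form_bound A bA (Num.max M 1).
have phiM n x : `|phi n x| <= (C + C) * `|x|.
  apply: (le_trans (ler_normB _ _)); rewrite mulrDl.
  by apply: lerD; apply: (form_head_le _ _ _ _ AC) => i; [exact: uM | exact: wM].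
have phi0 x : phi n x @[n --> \oo] --> (0 : R).
  rewrite -[X in _ --> X](subrr (A (fcons x w'))).
  apply: cvgB; last exact: cvg_cst.
  exact: (IHB (form_tail A x) (form_tail_bounded A bA x)).
have phi_weak0 (F : set_system X) (l : nat -> R) : UltraFilter F -> F (unit_ball X) ->
    (forall n, phi n x @[x --> F] --> l n) -> l @ \oo --> (0 : R).
  (* The limits are B (u' n) - B w' for a form [B] in [k] variables, and the induction hypothesis
     applies to [B]. *)
  move=> uF FB phil; have [B bB AB] := form_ultralimit A bA F uF FB.
  have lE n : l n = B (u' n) - B w'.
    apply: (cvg_unique _ (phil n)); first exact: Rhausdorff.
    exact: (cvgB (AB (u' n)) (AB w')).
  have -> : l = (fun n => B (u' n) - B w') by apply/funext.
  rewrite -[X in _ --> X](subrr (B w')); apply: cvgB; last exact: cvg_cst.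
  exact: IHB.
have [Y [iota [iota_norm _]]] := Existence.completion_exists (@sup_seminorm R).
have h1 := @dunford_pettis_seq _ _ phi _ phiM phi0 phi_weak0 Y iota iota_norm
  (fun n => u n ord0) (w ord0) DP (uw ord0).
have cw : continuous (form_head A w').
  apply: (linear_le_continuous _ C).
  by apply: (form_head_le A w' M C AC) => i; exact: wM.
have h2 : A (fcons (u n ord0) w') @[n --> \oo] --> A (fcons (w ord0) w').
  exact: ((weak_cvgP _ _).1 (uw ord0) (exist _ (form_head A w') cw)).
(* A (u n) is the sum of phi n (u n ord0) and A (u n ord0, w'): the first tends to 0, the second is
   a fixed functional along a weakly convergent sequence. *)
have := cvgD h1 h2; rewrite add0r fcons_eta.
rewrite (_ : _ + _ = fun n => A (u n)) => [h|]; first exact: (h _).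
apply/funext => n.
by rewrite -[LHS]/(A (fcons (u n ord0) (u' n)) - A _ + A _) subrK fcons_eta.
Qed.

(** * Polarization *)

Lemma mform_sum {R : realType} {X : normedModType R} (J : finType) (P : pred J)
    (k : nat) (B : multiform X k) (w : J -> X) :
  B (fun=> \sum_(j | P j) w j) =
  \sum_(g : {ffun 'I_k -> J} | [forall i, P (g i)]) B (w \o g).
Proof.
elim: k B => [|k IH] B.
  rewrite (big_pred1 (ffun0 (card_ord 0))).
    by congr (B _); apply/funext => -[].
  move=> g /=; apply/forallP/eqP => [_|_ []//].
  by apply/ffunP => -[].
have -> : (fun=> \sum_(j | P j) w j)
    = fcons (\sum_(j | P j) w j) (fun _ : 'I_k => \sum_(j | P j) w j).
  by apply/funext => i; rewrite /fcons; case: unliftP.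
rewrite -[LHS]/(form_head B _ _) linear_sum /=.
under eq_bigr => j _.
  rewrite -[B _]/(form_tail B (w j) _) IH /=.
  over.
rewrite pair_big /=.
(* [h] and [h'] match a choice function with its first value and its remaining values. *)
pose h (p : J * {ffun 'I_k -> J}) : {ffun 'I_k.+1 -> J} := [ffun i => fcons p.1 p.2 i].
pose h' (g : {ffun 'I_k.+1 -> J}) := (g ord0, [ffun i => g (lift ord0 i)]).
have hK : cancel h h'.
  move=> [j g]; congr (_, _); first by rewrite ffunE fcons0.
  by apply/ffunP => i; rewrite !ffunE fcons_lift.
have h'K : cancel h' h.
  move=> g; apply/ffunP => i; rewrite ffunE /fcons /=.
  by case: unliftP => [m|] -> //=; rewrite ffunE.
rewrite [RHS](reindex h); last by exists h' => ? _.
apply: eq_big => [[j g]|[j g] _] /=.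
  apply/andP/forallP => [[Pj /forallP Pg] i|Pg].
    by rewrite ffunE /fcons; case: unliftP => [m|] _ /=.
  split; first by have := Pg ord0; rewrite ffunE fcons0.
  by apply/forallP => i; have := Pg (lift ord0 i); rewrite ffunE fcons_lift.
congr (B _); apply/funext => i; rewrite /= ffunE /fcons.
by case: unliftP.
Qed.

(** Inclusion-exclusion: the sum expands a product whose factor at [i] is 1 if [P i] and 0
    otherwise. *)
Lemma sum_sign_supersets {R : realType} (I : finType) (P : pred I) :
  \sum_(S : {set I} | [forall i, P i ==> (i \in S)]) (-1) ^+ #|~: S| =
  [forall i, P i]%:R :> R.
Proof.
transitivity (\prod_(i : I) (1 + (if P i then 0 else -1)) : R).
  rewrite bigA_distr big_mkcond /=; apply: eq_bigr => S _.
  case: ifP => [/forallP PS|/negbT]; last first.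
    rewrite negb_forall => /existsP[i]; rewrite negb_imply => /andP[Pi iS].
    by rewrite (bigD1 i) //= (negPf iS) Pi mul0r.
  rewrite -prodr_const [LHS]big_mkcond /=; apply: eq_bigr => i _.
  have := PS i; rewrite finset.in_setC; case: (i \in S) => //=.
  by rewrite implybF => /negPf ->.
case: (boolP [forall i, P i]) => [/forallP PI|].
  by rewrite big1 // => i _; rewrite PI addr0.
rewrite negb_forall => /existsP[i Pi].
by rewrite (bigD1 i) //= (negPf Pi) subrr mul0r.
Qed.

Lemma ffun_surj_inj (I : finType) (g : {ffun I -> I}) :
  (forall i, i \in codom g) -> injective g.
Proof.
move=> gs; apply/injectiveP/card_uniqP.
rewrite size_map -cardE; apply: eq_card => i; by rewrite gs.
Qed.

Section SymmetricTensors.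
Context {R : realType} {X : normedModType R} {N : nat}.

Lemma power_subproof (x : X) : tensor_power N x \in @is_sym_tensor R X N.
Proof.
apply/asboolP; exists [:: (1, x)].
by rewrite /power_sum big_seq1 scale1r.
Qed.

Definition sym_power (x : X) : sym_tensor X N := SymTensor (power_subproof x).

(** N! times the symmetrization of the elementary tensor of [v], written with powers only. *)
Definition polarization (v : 'I_N -> X) : sym_tensor X N :=
  \sum_(S : {set 'I_N}) (-1) ^+ #|~: S| *: sym_power (\sum_(i in S) v i).

Lemma sym_val_sum (I : finType) (F : I -> sym_tensor X N) B :
  val (\sum_i F i) B = \sum_i val (F i) B.
Proof. by rewrite raddf_sum fct_sumE. Qed.

(** Expanding the powers, B (v \o g) occurs for each [S] containing the range of [g]; the signs
    cancel unless [g] is onto. *)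
Lemma polarizationE v B : val (polarization v) B =
  \sum_(g : {ffun 'I_N -> 'I_N} | [forall i, i \in codom g]) B (v \o g).
Proof.
rewrite sym_val_sum.
under eq_bigr => S _.
  have -> : val ((-1) ^+ #|~: S| *: sym_power (\sum_(i in S) v i)) B
      = (-1) ^+ #|~: S| * B (fun=> \sum_(i in S) v i) by [].
  rewrite mform_sum mulr_sumr.
  over.
rewrite (exchange_big_dep xpredT) //= [RHS]big_mkcond /=; apply: eq_bigr => g _.
rewrite -mulr_suml.
rewrite (eq_bigl (fun S : {set 'I_N} => [forall i, (i \in codom g) ==> (i \in S)])).
  by rewrite sum_sign_supersets; case: ifP; rewrite ?mul1r ?mul0r.
move=> S /=; apply/forallP/forallP => gS i.
  by apply/implyP => /codomP[j ->].
by have := implyP (gS (g i)) (codom_f g i).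
Qed.

(** A surjection [g] of a finite set is injective, so [v i] fills exactly one slot of [v \o g]. *)
Lemma polarization_linear (v : 'I_N -> X) i a y z :
  polarization (dfwith v i (a *: y + z)) =
  a *: polarization (dfwith v i y) + polarization (dfwith v i z).
Proof.
apply: val_inj; apply/funext => B.
rewrite -[RHS]/(a * val (polarization _) B + val (polarization _) B) !polarizationE.
rewrite mulr_sumr -big_split; apply: eq_bigr => g /forallP /= gs.
have [j ij] := codomP (gs i).
have gE x : dfwith v i x \o g = dfwith (v \o g) j x.
  apply/funext => m; rewrite /= !dfwithE {1}ij.
  by rewrite (inj_eq (ffun_surj_inj _ _ gs)).
by rewrite !gE mform_linear.
Qed.

(** [c] counts the surjections of the index set, among them the identity. *)
Lemma polarization_diag : exists2 c : R, c != 0 &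
  forall x, polarization (fun=> x) = c *: sym_power x.
Proof.
pose P := [pred g : {ffun 'I_N -> 'I_N} | [forall i, i \in codom g]].
exists (#|P|%:R).
  rewrite pnatr_eq0 -lt0n; apply/card_gt0P; exists [ffun i => i].
  by apply/forallP => i; apply/codomP; exists i; rewrite ffunE.
move=> x; apply: val_inj; apply/funext => B; rewrite polarizationE.
rewrite -[RHS]/(#|P|%:R * B (fun=> x)) -[#|P|%:R]/(1 *+ #|P|) mulrnAl mul1r.
by rewrite -sumr_const; apply: eq_bigr.
Qed.

End SymmetricTensors.

(** * Projective symmetric tensor products *)

Lemma mform_scale {R : realType} {X : normedModType R} {k : nat}
    (B : multiform X k) (a : R) (x : X) :
  B (fun=> a *: x) = a ^+ k * B (fun=> x).
Proof.
have cst n (z : X) : (fun=> z) = fcons z (fun _ : 'I_n => z).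
  by apply/funext => i; rewrite /fcons; case: unliftP.
elim: k B => [|k IH] B.
  by rewrite expr0 mul1r; congr (B _); apply/funext => -[].
rewrite !cst -[LHS]/(form_head B _ _) linearZ /=.
by rewrite -[B _]/(form_tail B x _) IH [LHS]mulrA exprS.
Qed.

Lemma sym_power_scale {R : realType} {X : normedModType R} {N : nat} (a : R) (x : X) :
  sym_power (a *: x) = a ^+ N *: sym_power x :> sym_tensor X N.
Proof. by apply: val_inj; apply/funext => B; exact: mform_scale. Qed.

Lemma sym_powerE {R : realType} {X : normedModType R} {N : nat}
    (u : sym_tensor X N) (s : seq (R * X)) :
  val u = power_sum N s -> u = \sum_(p <- s) p.1 *: sym_power p.2.
Proof. by move=> us; apply: val_inj; rewrite us raddf_sum. Qed.

Lemma prod_form_linear {R : realType} {X : normedModType R} {N : nat}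
    (h : 'I_N -> {linear X -> R^o}) (v : 'I_N -> X) i a x y :
  \prod_j (h j (dfwith v i (a *: x + y) j) : R) =
  a * (\prod_j (h j (dfwith v i x j) : R)) + \prod_j (h j (dfwith v i y j) : R).
Proof.
have E z : \prod_j (h j (dfwith v i z j) : R)
    = h i z * \prod_(j | j != i) (h j (v j) : R).
  rewrite (bigD1 i) //= dfwithE eqxx; congr (_ * _).
  by apply: eq_bigr => j /negPf ji; rewrite dfwithE ji.
by rewrite !E linearP mulrDl mulrA.
Qed.

Definition prod_form {R : realType} {X : normedModType R} {N : nat}
  (h : 'I_N -> {linear X -> R^o}) : multiform X N :=
  @Multiform R X N (fun v => \prod_j (h j (v j) : R)) (prod_form_linear h).

(** This yields lower bounds for the norm: a contractive polynomial is estimated term by term on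
    every representation of [u]. *)
Lemma le_proj_sym_norm {R : realType} {X : completeNormedModType R} {N : nat}
    (B : multiform X N) (u : sym_tensor X N) :
  (forall x, `|B (fun=> x)| <= `|x| ^+ N) -> `|val u B| <= proj_sym_norm u.
Proof.
move=> hB; apply: Existence.ge_cost => s ->.
rewrite /power_sum fct_sumE; apply: (le_trans (ler_norm_sum _ _ _)).
apply: ler_sum => p _.
rewrite [leLHS]normrM ler_wpM2l //; exact: hB.
Qed.

Lemma dualD {R : realType} {X : normedModType R} (f : dual X) x y :
  f (x + y) = f x + f y.
Proof. exact: (raddfD (sval f)). Qed.

Lemma dualZ {R : realType} {X : normedModType R} (f : dual X) a x :
  f (a *: x) = a * f x.
Proof. exact: (linearZ_LR (sval f)). Qed.

Lemma dual_sum {R : realType} {X : normedModType R} (f : dual X) {I : Type}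
    (s : seq I) (F : I -> X) : f (\sum_(i <- s) F i) = \sum_(i <- s) f (F i).
Proof. exact: (raddf_sum (sval f)). Qed.

Section ProjectiveSymmetricTensors.
Context {R : realType} {X : completeNormedModType R} {N : nat}.
Context {Z : completeNormedModType R} {iota : {linear sym_tensor X N -> Z}}.
Hypothesis Z_proj : is_proj_sym_tensor iota.

Lemma sym_power_norm_le x : `|iota (sym_power x)| <= `|x| ^+ N.
Proof.
rewrite Z_proj.1; apply: le_trans (Existence.le_cost (s := [:: (1, x)]) _) _.
  by rewrite /power_sum big_seq1 scale1r.
by rewrite big_seq1 normr1 mul1r.
Qed.

Lemma polarization_form_linear (f : dual Z) (v : 'I_N -> X) i a y z :
  f (iota (polarization (dfwith v i (a *: y + z)))) =
  a * f (iota (polarization (dfwith v i y))) + f (iota (polarization (dfwith v i z))).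
Proof. by rewrite polarization_linear linearP [LHS](linearP (sval f)). Qed.

(** A nonzero multiple of the symmetric form whose diagonal is x -> f (x^N). *)
Definition polarization_form (f : dual Z) : multiform X N :=
  @Multiform _ _ _ (fun v => f (iota (polarization v))) (polarization_form_linear f).

Lemma polarization_form_bounded (f : dual Z) : bounded_form (polarization_form f).
Proof.
move=> M; have [C fC] := dual_le f.
(* Each sum over a subset has at most N terms of norm at most M. *)
exists (\sum_(S : {set 'I_N}) `|C| * (N%:R * M) ^+ N) => v vM.
have -> : polarization_form f v =
    \sum_(S : {set 'I_N}) (-1) ^+ #|~: S| * f (iota (sym_power (\sum_(i in S) v i))).
  rewrite /= [polarization v]/polarization linear_sum dual_sum.
  by apply: eq_bigr => S _; rewrite linearZ dualZ.
apply: (le_trans (ler_norm_sum _ _ _)); apply: ler_sum => S _.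
rewrite normrM normrX normrN1 expr1n mul1r.
apply: (le_trans (fC _)).
apply: (@le_trans _ _ (`|C| * `|iota (sym_power (\sum_(i in S) v i))|)).
  by rewrite ler_wpM2r ?ler_norm.
rewrite ler_wpM2l //; apply: (le_trans (sym_power_norm_le _)).
have le_NM : `|\sum_(i in S) v i| <= N%:R * M.
  apply: (le_trans (ler_norm_sum _ _ _)).
  apply: (@le_trans _ _ (\sum_(i < N) `|v i|)).
    by rewrite [leLHS]big_mkcond /=; apply: ler_sum => i _; case: ifP.
  rewrite -[N in leRHS]card_ord mulr_natl -sumr_const; exact: ler_sum.
by rewrite lerXn2r ?nnegrE // (le_trans _ le_NM).
Qed.

Lemma sym_power_weakly_continuous (f : dual Z) (u : nat -> X) (w : X) (M : R) :
  dunford_pettis X -> (forall n, `|u n| <= M) ->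
  (u : nat -> weak X) @ \oo --> (w : weak X) ->
  f (iota (sym_power (u n))) @[n --> \oo] --> f (iota (sym_power w)).
Proof.
move=> DP uM uw; have [c c0 cE] := @polarization_diag R X N.
have E x : f (iota (sym_power x)) = c^-1 * polarization_form f (fun=> x).
  by rewrite /= cE linearZ dualZ mulrA mulVf ?mul1r.
rewrite E; under eq_fun do rewrite E.
apply: cvgMl_tmp.
exact: (form_weakly_continuous DP _ _ (polarization_form_bounded f)
  (fun n _ => u n) (fun=> w) M (fun n _ => uM n) (fun=> uw)).
Qed.

(** Otherwise |f| <= 1 - alpha on all powers of unit vectors; the definition of the norm and density
    would spread a bound below 1 to the whole unit ball. *)
Lemma slice_sym_power (f : dual Z) (alpha : R) :
  (exists x : X, x != 0) -> (0 < N)%N -> dual_norm f = 1 -> 0 < alpha ->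
  exists2 x : X, `|x| = 1 & 1 - alpha < `|f (iota (sym_power x))|.
Proof.
move=> [x0 x0_neq0] N0 f1 a0; apply: contrapT => noX.
have fS x : `|x| = 1 -> `|f (iota (sym_power x))| <= 1 - alpha.
  by move=> x1; rewrite leNgt; apply/negP => xa; apply: noX; exists x.
(* 1 - alpha could be 0; halving alpha makes the constant positive and still below 1. *)
pose c := 1 - alpha / 2.
have normalize (x : X) : x != 0 -> `| `|x|^-1 *: x | = 1.
  by move=> xn0; rewrite normrZ normfV normr_id mulVf // normr_eq0.
have c0 : 0 < c.
  have := le_trans (normr_ge0 _) (fS _ (normalize _ x0_neq0)); rewrite /c; lra.
have fP x : `|f (iota (sym_power x))| <= c * `|x| ^+ N.
  have [->|xn0] := eqVneq x 0.
    have -> : sym_power (0 : X) = 0 :> sym_tensor X N.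
      by rewrite -(scale0r (0 : X)) sym_power_scale expr0n gtn_eqF // scale0r.
    rewrite linear0 -(scale0r (0 : Z)) dualZ mul0r normr0.
    by rewrite mulr_ge0 ?exprn_ge0 // ltW.
  have -> : sym_power x = `|x| ^+ N *: sym_power (`|x|^-1 *: x) :> sym_tensor X N.
    by rewrite -sym_power_scale scalerA mulfV ?normr_eq0 // scale1r.
  rewrite linearZ dualZ normrM ger0_norm ?exprn_ge0 //.
  rewrite mulrC ler_wpM2r ?exprn_ge0 //; apply: (le_trans (fS _ (normalize _ xn0))).
  rewrite /c; lra.
have fU u : `|f (iota u)| <= c * `|iota u|.
  rewrite Z_proj.1 mulrC -ler_pdivrMr //; apply: Existence.ge_cost => s us.
  rewrite ler_pdivrMr // (sym_powerE _ _ us) linear_sum dual_sum.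
  apply: (le_trans (ler_norm_sum _ _ _)); rewrite mulr_suml.
  apply: ler_sum => p _; rewrite linearZ dualZ normrM -mulrA.
  by rewrite ler_wpM2l // mulrC.
have fZ z : `|f z| <= c * `|z|.
  have [C fC] := dual_le f.
  (* [K] collects the factors of |z - iota u|: [c] from replacing |iota u| by |z|, |C| from the
     continuity of [f], and 1 for positivity. *)
  apply/ler_addgt0Pr => d d0; pose K := c + `|C| + 1.
  have K0 : 0 < K by rewrite /K ltr_wpDl // addr_ge0 // ltW.
  have [z' [zy [u _ uz]]] : ball z (d / K) `&` range iota !=set0.
    apply: Z_proj.2; last exact: ball_open.
    by exists z; exact: (ballxx z (divr_gt0 d0 K0)).
  move: zy; rewrite -uz -ball_normE /= ltr_pdivlMr // => zu.
  have -> : f z = f (z - iota u) + f (iota u).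
    by rewrite -[RHS](raddfD (sval f)) subrK.
  apply: (le_trans (ler_normD _ _)).
  have h1 := fC (z - iota u).
  have h2 : C * `|z - iota u| <= `|C| * `|z - iota u| by rewrite ler_wpM2r ?ler_norm.
  have h3 := fU u.
  have h4 : c * `|iota u| <= c * (`|z| + `|z - iota u|).
    rewrite ler_wpM2l ?(ltW c0) // -[X in `|X| <= _](subrK z) addrC.
    by rewrite (le_trans (ler_normD _ _)) // distrC addrC.
  have h5 : c * `|z - iota u| + `|C| * `|z - iota u| + `|z - iota u| < d.
    by rewrite -mulrDl -[X in _ + X]mul1r -mulrDl mulrC.
  move: h4; rewrite mulrDr; have := normr_ge0 (z - iota u). lra.
have : dual_norm f <= c.
  apply: ge_sup => [|_ [z /= z1 <-]].
    by exists `|f 0|, 0; rewrite /unit_ball /= ?normr0.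
  by apply: (le_trans (fZ z)); rewrite ler_piMr // ltW.
rewrite f1 /c; lra.
Qed.

End ProjectiveSymmetricTensors.

(** * Distances between powers and the diameter of slices *)

Lemma cvgX {R : realType} {T : Type} (F : set_system T) (g : T -> R) (a : R) n :
  Filter F -> g @ F --> a -> g x ^+ n @[x --> F] --> a ^+ n.
Proof.
by move=> FF ga; exact: (cvg_comp g (fun z => z ^+ n) ga (@exprn_continuous R n a)).
Qed.

(* The form witnesses that (x + y)^N and (x - y)^N are far apart: it is the product
   of N - 1 copies of a functional norming x and one norming y. *)
Lemma sym_power_dist {R : realType} {X : completeNormedModType R} {N : nat}
    (f g : {linear X -> R^o}) (a b : X) (s t : R) :
  (forall z, `|f z| <= `|z|) -> (forall z, `|g z| <= `|z|) ->
  `|s * (f a ^+ N * g a) - t * (f b ^+ N * g b)| <=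
    proj_sym_norm (s *: sym_power a - t *: sym_power b : sym_tensor X N.+1).
Proof.
move=> f1 g1.
pose B := prod_form (fun i : 'I_N.+1 => if i == ord0 then g else f).
have BE z : B (fun=> z) = f z ^+ N * g z.
  rewrite /= big_ord_recl eqxx mulrC; congr (_ * _).
  under eq_bigr => i _ do rewrite -(inj_eq val_inj) /=.
  by rewrite prodr_const card_ord.
rewrite -!BE.
have := le_proj_sym_norm B (s *: sym_power a - t *: sym_power b); apply => z.
by rewrite BE normrM normrX exprSr ler_pM ?exprn_ge0 // lerXn2r ?nnegrE.
Qed.

Lemma diameter_slice_le {R : realType} {Z : normedModType R} (f : dual Z) alpha :
  (diameter (slice f alpha) <= 2%:E)%E.
Proof.
apply: ge_ereal_sup => _ [[p q] [[p1 _] [q1 _]] <-]; rewrite lee_fin /=.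
apply: (le_trans (ler_normB _ _)).
have : `|p| + `|q| <= 1 + 1 := lerD p1 q1; lra.
Qed.

Theorem proposition3p6 (R : realType) (X : completeNormedModType R)
    (X_neq0 : exists x : X, x != 0)
    (X_DPP : dunford_pettis X) (X_wasq : weakly_almost_square X)
    (N : nat) (N_gt0 : (0 < N)%N)
    (Z : completeNormedModType R) (iota : {linear sym_tensor X N -> Z})
    (Z_proj : is_proj_sym_tensor iota) :
  local_diameter_two Z.
Proof.
(* From here the power is [N.+1], which leaves [N] factors x* and one factor y_n*. *)
case: N N_gt0 iota Z_proj => // N _ iota Z_proj f alpha f1 alpha0.
have [x x1 xf] := slice_sym_power Z_proj f alpha X_neq0 isT f1 alpha0.
have [y [yB [xDy xBy] y1 y0]] := X_wasq x x1.
pose P z := f (iota (sym_power z)).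
(* The sign that makes e * P x = |P x|. *)
pose e : R := (-1) ^+ (P x < 0)%R.
pose a n := x + y n; pose b n := x - y n.
have weak_x s : (fun n => x + s *: y n : weak X) @ \oo --> (x : weak X).
  apply/weak_cvgP => g.
  have gE n : g (x + s *: y n) = g x + s * g (y n) by rewrite dualD dualZ.
  have gy := (weak_cvgP _ _).1 y0 g.
  have -> : g x = g x + s * g 0 by rewrite -dualZ -dualD scaler0 addr0.
  under eq_fun do rewrite gE.
  by apply: cvgD; [exact: cvg_cst | exact: cvgMl_tmp].
have cvgP s : `|s| = 1 -> P (x + s *: y n) @[n --> \oo] --> P x.
  move=> s1; apply: (sym_power_weakly_continuous Z_proj f _ x 2) => // n.
  apply: (le_trans (ler_normD _ _)); rewrite x1 normrZ s1 mul1r.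
  have := yB n; rewrite /unit_ball /=; lra.
have Pa : P (a n) @[n --> \oo] --> P x.
  by have := cvgP 1 (normr1 _); under eq_fun do rewrite scale1r.
have Pb : P (b n) @[n --> \oo] --> P x.
  by have := cvgP (- 1) (normrN1 _); under eq_fun do rewrite scaleN1r.
pose point z : Z := (e * `|z| ^- N.+1) *: iota (sym_power z).
have point_ball z : unit_ball Z (point z).
  rewrite /unit_ball /= normrZ normrM normr_sign mul1r ger0_norm ?invr_ge0 ?exprn_ge0 //.
  have := sym_power_norm_le Z_proj z.
  (* At z = 0 the inverse is 0 by convention, and so is the point. *)
  have [->|z0] := eqVneq z 0; first by rewrite normr0 expr0n invr0 mul0r.
  by rewrite mulrC ler_pdivrMr ?mul1r // exprn_gt0 // normr_gt0.
have point_slice (c : nat -> X) : `|c n| @[n --> \oo] --> (1 : R) ->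
    P (c n) @[n --> \oo] --> P x -> \forall n \near \oo, slice f alpha (point (c n)).
  move=> c1 cP.
  have : e * `|c n| ^- N.+1 * P (c n) @[n --> \oo] --> e * 1 ^- N.+1 * P x.
    apply: cvgM => //; apply: cvgM; first exact: cvg_cst.
    by apply: cvgV; [rewrite expr1n oner_eq0 | exact: cvgX].
  rewrite expr1n invr1 mulr1 -normrEsign => /cvgr_gt/(_ _ xf).
  by apply: filterS => n h; split; [exact: point_ball | rewrite /= dualZ].
have sa := point_slice a xDy Pa; have sb := point_slice b xBy Pb.
have [xs [xs_le xsx]] := norming_functional x.
have /choice[ys ysP] : forall n, exists g : {linear X -> R^o},
  (forall z, `|g z| <= `|z|) /\ g (y n) = `|y n|.
  by move=> n; exact: norming_functional.
have xsy : xs (y n) @[n --> \oo] --> (0 : R).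
  have cxs : continuous xs by apply: (linear_le_continuous _ 1) => z; rewrite mul1r.
  have := (weak_cvgP _ _).1 y0 (exist _ xs cxs).
  by rewrite [dual_fun _ 0](linear0 xs).
have ysx : ys n x @[n --> \oo] --> (0 : R).
  (* As y_n* norms y_n, its values at x + y_n and y_n - x are |y_n| + y_n*(x) and |y_n| - y_n*(x),
     at most |a n| and |b n|. *)
  apply: (@squeeze_cvgr _ _ _ _ (fun n => `|y n| - `|b n|) (fun n => `|a n| - `|y n|)).
  - apply: nearW => n; have [ys_le ysy] := ysP n.
    have := le_trans (ler_norm _) (ys_le (a n)).
    have := le_trans (ler_norm _) (ys_le (- b n)).
    rewrite normrN /a /b opprB linearB linearD /= ysy.
    by rewrite lerBlDr => h1 h2; apply/andP; split; lra.
  - by rewrite -(subrr (1 : R)); exact: cvgB.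
  - by rewrite -(subrr (1 : R)); exact: cvgB.
pose D n := `|a n| ^- N.+1 * (xs (a n) ^+ N * ys n (a n))
          - `|b n| ^- N.+1 * (xs (b n) ^+ N * ys n (b n)).
have D2 : D n @[n --> \oo] --> (2 : R).
  (* At x + t y_n the values of x* and y_n* tend to 1 and t; t = 1 and t = -1 give the two terms. *)
  have half (c : nat -> X) t : `|c n| @[n --> \oo] --> (1 : R) ->
      (forall n, c n = x + t *: y n) ->
      `|c n| ^- N.+1 * (xs (c n) ^+ N * ys n (c n)) @[n --> \oo] --> t.
    move=> c1 cE.
    have -> : t = 1 ^- N.+1 * ((1 + t * 0) ^+ N * (0 + t * 1)).
      by rewrite mulr0 addr0 !expr1n add0r mulr1 invr1 !mul1r.
    apply: cvgM.
      by apply: cvgV; [rewrite expr1n oner_eq0 | exact: cvgX].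
    apply: cvgM.
      apply: cvgX; under eq_fun do rewrite cE linearD linearZ /= xsx x1.
      by apply: cvgD; [exact: cvg_cst | exact: cvgMl_tmp].
    under eq_fun do rewrite cE linearD linearZ /= (ysP _).2.
    by apply: cvgD => //; exact: cvgMl_tmp.
  have := cvgB (half a 1 xDy _) (half b (- 1) xBy _).
  rewrite opprK; apply => n; first by rewrite scale1r.
  by rewrite scaleN1r.
have Dle n : D n <= `|point (a n) - point (b n)|.
  have [ys_le _] := ysP n.
  have := sym_power_dist (N := N) xs (ys n) (a n) (b n)
    (e * `|a n| ^- N.+1) (e * `|b n| ^- N.+1) xs_le ys_le.
  rewrite -Z_proj.1 (linearB iota) (linearZ_LR iota) (linearZ_LR iota); apply: le_trans.
  rewrite -!mulrA -mulrBr normrM normr_sign mul1r; exact: ler_norm.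
apply/le_anti/andP; split; first exact: diameter_slice_le.
apply/lee_addgt0Pr => d d0.
have dlt : 2 - d < 2 by rewrite ltrBlDr ltrDl.
have [n [Dn [an bn]]] := filter_ex (filterI (cvgr_ge _ D2 _ dlt) (filterI sa sb)).
apply: (@le_trans _ _ (`|point (a n) - point (b n)| + d)%:E).
  by rewrite lee_fin -lerBlDr (le_trans Dn).
rewrite EFinD leeD2r //; apply: ereal_sup_ubound.
by exists (point (a n), point (b n)).
Qed.
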